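(* Let $\theta\in[\tfrac12,1]$, $\epsilon>0$, $\beta>0$, $\lambda_1,\lambda_2,\lambda_3>0$, and let the time steps have adjacent ratios satisfying $0\le\gamma_{n+1}\le\gamma_*$ for all $n$. Suppose the mobility $M$ is a positive constant. Let $(\phi^n)$ (functions on $\Omega$) and $(u^n)$ (real numbers) be a solution of the $\mathcal V_W$-method, i.e. for every $n\ge1$, $$\tilde D_\tau^{\theta}\phi^{n+\theta}=\nabla\cdot\big(M\nabla\mu^{n+\theta}\big),$$ $$\mu^{n+\theta}=\frac{u^{n+1}}{\sqrt{\widetilde E_2^{n}}}V(\xi^{n+1})\mathcal Z^{*,n+\theta}+\frac{\lambda_1}{\epsilon^2}\phi^{n+\theta}-\lambda_2\Delta\phi^{n+\theta}+\lambda_3\Delta^2\phi^{n+\theta},$$ $$\frac{u^{n+1}-u^n}{\tau_{n+1}}=\frac{V(\xi^{n+1})}{2\sqrt{\widetilde E_2^{n}}}\int_\Omega\mathcal Z^{*,n+\theta}\,\frac{\phi^{n+1}-\phi^n}{\tau_{n+1}}\,d\Omega,\qquad \xi^{n+1}=\frac{u^{n+1}}{\sqrt{\widetilde E_2^{n}}},$$ with $\int_\Omega\phi^1d\Omega=\int_\Omega\phi^0d\Omega$. Then the method is unconditionally energy stable: for every $1\le n\le N-2$, $$\tilde{\mathcal E}_W^{n+1}-\tilde{\mathcal E}_W^{n}\le 0,$$ where $$\tilde{\mathcal E}_W^{n+1}=\frac{(2\theta-1)\gamma_{n+2}^{3/2}}{2(1+\gamma_{n+2})}\frac{\|\nabl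a^{-1}(\phi^{n+1}-\phi^n)\|^2}{M\tau_{n+1}}+\frac{\lambda_1}{2\epsilon^2}\|\phi^{n+1}\|^2+\frac{\lambda_2}2\|\nabla\phi^{n+1}\|^2+\frac{\lambda_3}2\|\Delta\phi^{n+1}\|^2+|u^{n+1}|^2.$$
   Context: $\Omega\subset\mathbb R^d$ ($d=2,3$) is a bounded domain; all functions satisfy periodic boundary conditions (so integration by parts produces no boundary terms) and are sufficiently regular that all expressions below are well defined. $\|\cdot\|$ is the $L^2(\Omega)$ norm. For mean-zero $v$, $\Delta^{-1}v$ is the mean-zero periodic solution $w$ of $\Delta w=v$, and $\|\nabla^{-1}v\|^2:=(-\Delta^{-1}v,v)=\|\nabla\Delta^{-1}v\|^2$. Time mesh: $0=t_0<t_1<\cdots<t_N=T$, $\tau_n=t_n-t_{n-1}$, $\gamma_{n+1}=\tau_{n+1}/\tau_n$. The number $\gamma_*$ is the positive root of $(1-2\theta)^2\gamma_*^3-4\theta^2\gamma_*^2-4\theta\gamma_*-1=0$ (with $\gamma_*=+\infty$, i.e. no upper bound, if $\theta=\frac12$). For a sequence $(w^n)$, $$\tilde D_\tau^\theta w^{n+\theta}=\frac{1+2\theta\gamma_{n+1}}{\tau_{n+1}(1+\gamma_{n+1})}(w^{n+1}-w^n)+\frac{(1-2\theta)\gamma_{n+1}^2}{\tau_{n+1}(1+\gamma_{n+1})}(w^n-w^{n-1}),$$ $\phi^{n+\theta}=\theta\phi^{n+1}+(1-\theta)\phi^n$, $\phi^{*,n+\theta}=(1+\theta\gamma_{n+1})\phi^n-\theta\gamma_{n+1}\phi^{n-1}$.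 Anisotropic quantities: $\mathbf n=\nabla\phi/|\nabla\phi|$, $\gamma(\mathbf n)=1+\alpha\big(4\sum_{i=1}^d n_i^4-3\big)$ with $\alpha\ge0$ (not to be confused with the step ratios $\gamma_n$), $F(\phi)=\frac14(\phi^2-1)^2$, $f(\phi)=F'(\phi)=\phi(\phi^2-1)$, $f'(\phi)=3\phi^2-1$, $$\mathbf m=\gamma(\mathbf n)\nabla\phi+\frac{\mathbb P\nabla_{\mathbf n}\gamma(\mathbf n)}{|\nabla\phi|}\Big(\tfrac12|\nabla\phi|^2+\tfrac1{\epsilon^2}F(\phi)\Big),\qquad \mathbb P=\mathbb I-\mathbf n\mathbf n^T,$$ $$\mathcal Z(\phi)=\frac1{\epsilon^2}\gamma(\mathbf n)f(\phi)-\nabla\cdot\mathbf m+\beta\Big(\Delta-\frac1{\epsilon^2}f'(\phi)\Big)\Big(\Delta\phi-\frac1{\epsilon^2}f(\phi)\Big)-\frac{\lambda_1}{\epsilon^2}\phi+\lambda_2\Delta\phi-\lambda_3\Delta^2\phi,$$ $\mathcal Z^{*,n+\theta}=\mathcal Z(\phi^{*,n+\theta})$, $$\widetilde E_2(\phi)=\int_\Omega\Big(g(\phi)-\frac{\lambda_1}{2\epsilon^2}|\phi|^2-\frac{\lambda_2}2|\nabla\phi|^2-\frac{\lambda_3}2|\Delta\phi|^2\Big)d\Omega+C_0,\quad g(\phi)=\gamma(\mathbf n)\Big(\tfrac12|\nabla\phi|^2+\tfrac1{\epsilon^2}F(\phi)\Big)+\tfrac\beta2\Big(\Delta\phi-\tfrac1{\epsilon^2}f(\phi)\Big)^2,$$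 $\widetilde E_2^n=\widetilde E_2(\phi^n)$, where the constant $C_0>0$ is chosen so that $\widetilde E_2>0$. $V\in C^2(\mathbb R)$ is a positive real function with $V(1)=1$ and $\lim_{\xi\to1}\frac{V(\xi)-1}{1-\xi}=1$. *)

(* Defs.v *)
From HB Require Import structures.
From mathcomp Require Import all_boot all_order all_algebra.
From mathcomp Require Import all_classical all_reals all_analysis.
Set Implicit Arguments.
Unset Strict Implicit.
Unset Printing Implicit Defensive.
Import Order.TTheory GRing.Theory Num.Theory.
Import numFieldNormedType.Exports.
Local Open Scope classical_set_scope.
Local Open Scope ring_scope.

(* d-dimensional Lebesgue measure, carried by d-tuples (on which the library
   provides the product sigma-algebra) and built by iterating the binary
   product measure. *)

Section cons_measure.
Context (R : realType) (n : nat).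
Variable mu : {sigma_finite_measure set (n.-tuple (measurableTypeR R)) -> \bar R}.

Definition cons_pair (p : measurableTypeR R * n.-tuple (measurableTypeR R)) :
  n.+1.-tuple (measurableTypeR R) := [the n.+1.-tuple _ of p.1 :: p.2].

Lemma measurable_cons_pair : measurable_fun [set: _] cons_pair.
Proof. exact: measurable_cons. Qed.

Definition cons_measure : set (n.+1.-tuple (measurableTypeR R)) -> \bar R :=
  pushforward ((@lebesgue_measure R) \x mu)%E cons_pair.

Let cons_measure0 : cons_measure set0 = 0%E.
Proof. by rewrite /cons_measure /pushforward preimage_set0 measure0. Qed.

Let cons_measure_ge0 A : (0 <= cons_measure A)%E.
Proof. by rewrite /cons_measure /pushforward; apply: integral_ge0. Qed.

Let cons_measure_sigma_additive : semi_sigma_additive cons_measure.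
Proof.
have mpre A : measurable A -> measurable (cons_pair @^-1` A).
  by move=> mA; rewrite -[X in measurable X]setTI; exact: measurable_cons_pair.
move=> F mF tF mUF; rewrite /cons_measure /pushforward preimage_bigcup.
apply: measure_semi_sigma_additive => [k||].
- exact: mpre.
- apply/trivIsetP => i j _ _ ij; rewrite -preimage_setI.
  by move/trivIsetP : tF => /(_ _ _ _ _ ij) ->//; rewrite preimage_set0.
- by rewrite -preimage_bigcup; exact: mpre.
Qed.

HB.instance Definition _ := isMeasure.Build _ _ _ cons_measure
  cons_measure0 cons_measure_ge0 cons_measure_sigma_additive.

Lemma sigma_finite_cons_measure : sigma_finite [set: _] cons_measure.
Proof.
pose uncons (t : n.+1.-tuple (measurableTypeR R)) :=
  (thead t, [tuple of behead t]) : measurableTypeR R * n.-tuple (measurableTypeR R).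
have unconsK p : uncons (cons_pair p) = p.
  by case: p => x t; congr pair; exact/val_inj.
have muncons : measurable_fun [set: _] uncons.
  apply/measurable_fun_pairP; split.
  - exact: measurable_tnth.
  - exact: measurable_behead.
have /sigma_finiteP[F [FT ndF Ffin]] := sigma_finiteT (@lebesgue_measure R).
have /sigma_finiteP[G [GT ndG Gfin]] := sigma_finiteT mu.
exists (fun k => uncons @^-1` (F k `*` G k)).
  rewrite -preimage_bigcup (_ : \bigcup_k _ = setT) ?preimage_setT//.
  rewrite -subTset => -[x t] _ /=.
  have : (\bigcup_k F k) x by rewrite -FT.
  have : (\bigcup_k G k) t by rewrite -GT.
  move=> [j _ Gt] [i _ Fx]; exists (maxn i j) => //; split => /=.
  - by move: x Fx; exact/subsetPset/ndF/leq_maxl.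
  - by move: t Gt; exact/subsetPset/ndG/leq_maxr.
move=> k; have [mF Foo] := Ffin k; have [mG Goo] := Gfin k; split.
  rewrite -[X in measurable X]setTI; apply: muncons => //.
  exact: measurableX.
rewrite /cons_measure /pushforward -comp_preimage.
rewrite (_ : uncons \o cons_pair = id) ?funeqE// preimage_id.
by rewrite product_measure1E// lte_mul_pinfty// ge0_fin_numE.
Qed.

HB.instance Definition _ := Measure_isSigmaFinite.Build _ _ _
  cons_measure sigma_finite_cons_measure.

End cons_measure.

Fixpoint lebesgue_tuple (R : realType) (n : nat) :
    {sigma_finite_measure set (n.-tuple (measurableTypeR R)) -> \bar R} :=
  match n with
  | 0 => dirac [tuple]
  | n'.+1 => cons_measure (lebesgue_tuple R n')
  end.

(* Periodic boundary conditions: Omega is the box [0, L_1] x ... x [0, L_d] and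
   a field on Omega is an L-periodic function on R^d. *)

Section periodic_calculus.
Context (R : realType) (d : nat).
Implicit Types (f : 'rV[R]_d -> R) (F : 'rV[R]_d -> 'rV[R]_d) (x : 'rV[R]_d).

Definition pderiv (i : 'I_d) f x : R := 'D_(delta_mx 0 i) f x.
Definition grad f x : 'rV[R]_d := \row_i pderiv i f x.
Definition divg F x : R := \sum_i pderiv i (fun y => F y 0 i) x.
Definition lap f x : R := \sum_i pderiv i (pderiv i f) x.

(* The library norm on 'rV[R]_d is the sup norm. *)
Definition enorm (v : 'rV[R]_d) : R := Num.sqrt (\sum_i v 0 i ^+ 2).

Fixpoint of_class_C (k : nat) f : Prop :=
  match k with
  | 0 => continuous f
  | k'.+1 => continuous f /\
      forall i, (forall x, derivable f x (delta_mx 0 i)) /\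
                of_class_C k' (pderiv i f)
  end.

Variable L : 'I_d -> R.

Definition box_periodic f : Prop :=
  forall x i, f (x + L i *: delta_mx 0 i) = f x.

Definition periodic_C (k : nat) f : Prop := of_class_C k f /\ box_periodic f.

Definition of_coords (t : d.-tuple (measurableTypeR R)) : 'rV[R]_d :=
  \row_i (tnth t i : R).

Definition Omega : set (d.-tuple (measurableTypeR R)) :=
  [set t | forall i, 0 <= (tnth t i : R) <= L i].

Definition integral_Omega f : R :=
  \int[lebesgue_tuple R d]_(t in Omega) f (of_coords t).

Definition ae_Omega (P : 'rV[R]_d -> Prop) : Prop :=
  {ae lebesgue_tuple R d, forall t, Omega t -> P (of_coords t)}.

Definition L2norm f : R := Num.sqrt (integral_Omega (fun x => f x ^+ 2)).
Definition L2norm_grad f : R := L2norm (fun x => enorm (grad f x)).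

(* Any two such operators agree on the fields they are specified on, since the
   mean-zero periodic solution is unique. *)
Definition is_inverse_laplacian
    (invlap : ('rV[R]_d -> R) -> 'rV[R]_d -> R) : Prop :=
  forall v, periodic_C 4 v -> integral_Omega v = 0 ->
    [/\ periodic_C 2 (invlap v), integral_Omega (invlap v) = 0
      & forall x, lap (invlap v) x = v x].

Definition Hm1_normsq (invlap : ('rV[R]_d -> R) -> 'rV[R]_d -> R)
    (v : 'rV[R]_d -> R) : R :=
  integral_Omega (fun x => - invlap v x * v x).

End periodic_calculus.

Section anisotropic_energy.
Context (R : realType) (d : nat).
Variables (L : 'I_d -> R) (alpha beta eps lam1 lam2 lam3 C0 : R).
Implicit Types (phi : 'rV[R]_d -> R) (x n : 'rV[R]_d).

(* With 0^-1 = 0, the normal and the flux m below are 0 where the gradient of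
   phi vanishes, where the formulas they come from are undefined. *)
Definition unit_normal phi x : 'rV[R]_d := (enorm (grad phi x))^-1 *: grad phi x.

Definition aniso n : R := 1 + alpha * (4 * (\sum_i n 0 i ^+ 4) - 3).

Definition Fpot (s : R) : R := 4^-1 * (s ^+ 2 - 1) ^+ 2.
Definition fpot (s : R) : R := s * (s ^+ 2 - 1).
Definition dfpot (s : R) : R := 3 * s ^+ 2 - 1.

Definition tangent_proj n : 'M[R]_d := 1%:M - n^T *m n.

Definition base_density phi x : R :=
  2^-1 * enorm (grad phi x) ^+ 2 + (eps ^+ 2)^-1 * Fpot (phi x).

(* In the row-vector convention the symmetric matrix tangent_proj acts on the right. *)
Definition flux phi x : 'rV[R]_d :=
  let n := unit_normal phi x in
  aniso n *: grad phi x
  + ((enorm (grad phi x))^-1 * base_density phi x) *: (grad aniso n *m tangent_proj n).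

Definition willmore phi x : R := lap phi x - (eps ^+ 2)^-1 * fpot (phi x).

Definition Zop phi x : R :=
  (eps ^+ 2)^-1 * aniso (unit_normal phi x) * fpot (phi x)
  - divg (flux phi) x
  + beta * (lap (willmore phi) x
            - (eps ^+ 2)^-1 * dfpot (phi x) * willmore phi x)
  - lam1 / eps ^+ 2 * phi x
  + lam2 * lap phi x
  - lam3 * lap (lap phi) x.

Definition energy_density phi x : R :=
  aniso (unit_normal phi x) * base_density phi x + beta / 2 * willmore phi x ^+ 2.

Definition E2 phi : R :=
  integral_Omega L (fun x =>
    energy_density phi x - lam1 / (2 * eps ^+ 2) * phi x ^+ 2
    - lam2 / 2 * enorm (grad phi x) ^+ 2 - lam3 / 2 * lap phi x ^+ 2) + C0.

End anisotropic_energy.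

Section variable_steps.
Context (R : realType) (d : nat).
Variables (t : nat -> R) (theta : R).
Implicit Types (w : nat -> 'rV[R]_d -> R).

Definition tau (n : nat) : R := t n - t n.-1.
Definition step_ratio (n : nat) : R := tau n / tau n.-1.

(* In Dtheta, interp and extrap the index n stands for the superscript
   n + theta. *)
Definition Dtheta w (n : nat) (x : 'rV[R]_d) : R :=
  let g := step_ratio n.+1 in
  (1 + 2 * theta * g) / (tau n.+1 * (1 + g)) * (w n.+1 x - w n x)
  + (1 - 2 * theta) * g ^+ 2 / (tau n.+1 * (1 + g)) * (w n x - w n.-1 x).

Definition interp w (n : nat) (x : 'rV[R]_d) : R :=
  theta * w n.+1 x + (1 - theta) * w n x.

Definition extrap w (n : nat) (x : 'rV[R]_d) : R :=
  (1 + theta * step_ratio n.+1) * w n x - theta * step_ratio n.+1 * w n.-1 x.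

Definition is_gamma_star (g : \bar R) : Prop :=
  (theta = 2^-1 -> g = +oo%E) /\
  (theta <> 2^-1 -> exists r : R, [/\ 0 < r,
    (1 - 2 * theta) ^+ 2 * r ^+ 3 - 4 * theta ^+ 2 * r ^+ 2
      - 4 * theta * r - 1 = 0 & g = r%:E]).

Definition modified_energy (L : 'I_d -> R)
    (invlap : ('rV[R]_d -> R) -> 'rV[R]_d -> R) (M eps lam1 lam2 lam3 : R)
    (phi : nat -> 'rV[R]_d -> R) (u : nat -> R) (n : nat) : R :=
  (2 * theta - 1) * step_ratio n.+1 `^ (3 / 2) / (2 * (1 + step_ratio n.+1))
    * (Hm1_normsq L invlap (fun x => phi n x - phi n.-1 x) / (M * tau n))
  + lam1 / (2 * eps ^+ 2) * L2norm L (phi n) ^+ 2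
  + lam2 / 2 * L2norm_grad L (phi n) ^+ 2
  + lam3 / 2 * L2norm L (lap (phi n)) ^+ 2
  + `|u n| ^+ 2.

End variable_steps.

(* Main.v *)
(* Testing the first equation of the scheme with w = invlap (phi^{n+1} - phi^n)
   and the second one with phi^{n+1} - phi^n, and using the third one to
   eliminate the nonlinear term, gives an energy identity. The theta-averages of
   the three quadratic forms dominate half the increments of the squared norms.
   The discrete time derivative contributes a ||e||^2 + b (e, e') in H^{-1},
   with e, e' two successive increments and b <= 0; Young's inequality with weight
   gamma_{n+1}^{-1/2} bounds it below by a telescoping difference as soon as
     (2 theta - 1) g'^{3/2} / (1 + g')
       <= (2 + 4 theta g - (2 theta - 1) g^{3/2}) / (1 + g)
   for all ratios g, g' in [0, gamma_*]. The left side increases with g' and the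
   right side is at least its value at gamma_*, where both sides agree because
   the cubic for gamma_* says (2 theta - 1) gamma_*^{3/2} = 1 + 2 theta gamma_*.
   The integrations by parts reduce, by Fubini, to the fundamental theorem of
   calculus in one coordinate. *)
Require Import Defs.
From mathcomp Require Import all_boot all_order all_algebra.
From mathcomp Require Import all_classical all_reals all_analysis.
From mathcomp Require Import measurable_realfun ring lra.
Set Implicit Arguments.
Unset Strict Implicit.
Unset Printing Implicit Defensive.
Import Order.TTheory GRing.Theory Num.Theory.
Import numFieldNormedType.Exports.
Local Open Scope classical_set_scope.
Local Open Scope ring_scope.

(** * Measurability and integrability on the box *)

Section row_cons.
Context (R : realType) (n : nat).

(** The analogue of [cons_pair] on row vectors: [unlift ord0 k] is [None] exactly when [k] is the
    first coordinate. *)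
Definition row_cons (x : R) (v : 'rV[R]_n) : 'rV[R]_n.+1 :=
  \row_k oapp (fun j => v 0 j) x (unlift ord0 k).

Lemma of_coords_cons (x : R) (s : n.-tuple (measurableTypeR R)) :
  of_coords [tuple of (x : measurableTypeR R) :: s] = row_cons x (of_coords s).
Proof.
apply/rowP => k; rewrite !mxE; case: unliftP => [j|] ->/=; last by [].
by rewrite mxE tnthS.
Qed.

(** Shifts are written [h *: e + v], the form they take in the difference quotients defining
    [derive]. *)
Lemma row_cons_shift_tail (x h : R) v (j : 'I_n) :
  row_cons x (h *: delta_mx 0 j + v) =
  h *: delta_mx 0 (lift ord0 j) + row_cons x v.
Proof.
apply/rowP => k; rewrite !mxE/=; case: unliftP => [l|] ->/=.
  by rewrite !mxE eqxx/= (inj_eq (@lift_inj _ _)).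
by rewrite mulr0 add0r.
Qed.

Lemma row_cons_shift_head (x h : R) v :
  row_cons (h + x) v = h *: delta_mx 0 ord0 + row_cons x v.
Proof.
apply/rowP => k; rewrite !mxE/=; case: unliftP => [l|] ->/=.
  by rewrite mulr0 add0r.
by rewrite mulr1.
Qed.

Lemma row_cons_continuous (x : R) : continuous (row_cons x).
Proof.
move=> v A /nbhs_ballP[e e0 eA]; apply/nbhs_ballP; exists e => // w [_ vw].
apply: eA; split=> // i j; rewrite !mxE; case: unliftP => [l|] _ /=.
  exact: vw.
exact: ballxx.
Qed.

Lemma row_cons_head_continuous (v : 'rV[R]_n) :
  continuous (fun x : R => row_cons x v).
Proof.
move=> x A /nbhs_ballP[e e0 eA]; apply/nbhs_ballP; exists e => // y xy.
apply: eA; split=> // i j; rewrite !mxE; case: unliftP => [l|] _ //=.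
exact: ballxx.
Qed.

End row_cons.

Section box.
Context (R : realType).

Lemma measurable_tuple_box d (A : 'I_d -> set (measurableTypeR R)) :
  (forall i, measurable (A i)) ->
  measurable [set t : d.-tuple (measurableTypeR R) | forall i, A i (tnth t i)].
Proof.
move=> mA; rewrite (_ : mkset _ = \bigcap_(i in [set: 'I_d])
    ((@tnth d (measurableTypeR R) ^~ i) @^-1` A i)).
  apply: fin_bigcap_measurable => [|i _]; first exact: finite_finset.
  rewrite -[X in measurable X]setTI.
  by apply: measurable_tnth => //; exact: mA.
by apply/seteqP; split => t /= At i; [move=> _; exact: At|exact: At].
Qed.

Lemma measurable_Omega d (L : 'I_d -> R) : measurable (Omega L).
Proof.
rewrite (_ : Omega L =
    [set t | forall i, `[0, L i]%classic (tnth t i : R)]); last first.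
  by apply/seteqP; split => t Lt i; have := Lt i; rewrite /= in_itv.
by apply: (measurable_tuple_box (A := fun i => [set` `[0, L i]])) => i;
  exact: (measurable_itv `[0, L i]).
Qed.

Lemma cons_preimage_Omega n (L : 'I_n.+1 -> R) :
  @cons_pair R n @^-1` Omega L =
  `[0, L ord0]%classic `*` Omega (fun j => L (lift ord0 j)).
Proof.
apply/seteqP; split => -[x s]/=.
  move=> Ls; split; first by rewrite in_itv/=; exact: (Ls ord0).
  by move=> j; have := Ls (lift ord0 j); rewrite tnthS.
move=> [+ Ls]; rewrite in_itv/= => Lx i.
case: (unliftP ord0 i) => [j|] ->; last exact: Lx.
by rewrite tnthS; exact: Ls.
Qed.

(** By induction on the dimension: the measure of the box is an interval length times the measure of
    the tail box. *)
Lemma lebesgue_tuple_Omega_lty d (L : 'I_d -> R) :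
  (lebesgue_tuple R d (Omega L) < +oo)%E.
Proof.
elim: d L => [|n IH] L /=.
  by rewrite diracE; case: (_ \in _); rewrite ltry.
rewrite /cons_measure /pushforward cons_preimage_Omega.
rewrite product_measure1E; [|exact: (measurable_itv `[0, L ord0])
                           |exact: measurable_Omega].
rewrite lte_mul_pinfty//.
by rewrite /= lebesgue_measure_itv/=; case: ifP.
Qed.

(** An open set is the countable union of the cubes with rational centre and radius [1/(k+1)] that
    it contains, and the preimage of a cube is a product of intervals, hence measurable for the
    product sigma-algebra. *)
Lemma measurable_of_coords_open d (U : set 'rV[R]_d) : open U ->
  measurable (@of_coords R d @^-1` U).
Proof.
move=> oU.
pose B (qk : d.-tuple rat * nat) : set 'rV[R]_d :=
  [set x | forall i, ball (ratr (tnth qk.1 i) : R) qk.2.+1%:R^-1 (x 0 i)].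
pose F qk := @of_coords R d @^-1` (B qk `&` [set x | B qk `<=` U]).
have mF qk : measurable (F qk).
  have [BU|BU] := pselect (B qk `<=` U); last first.
    by rewrite (_ : F qk = set0)//; apply/seteqP; split => // t [].
  rewrite (_ : F qk = [set t | forall i,
      ball (ratr (tnth qk.1 i) : R) qk.2.+1%:R^-1 (tnth t i : R)]).
    by apply: (measurable_tuple_box
      (A := fun i => ball (ratr (tnth qk.1 i) : R) qk.2.+1%:R^-1)) => i;
      apply: (@open_measurable R); apply: ball_open; rewrite invr_gt0 ltr0n.
  apply/seteqP; split => t.
    by move=> [Bt _] i /=; have := Bt i; rewrite mxE.
  by move=> /= Bt; split => // i; rewrite mxE; exact: Bt.
rewrite (_ : _ @^-1` _ = \bigcup_qk F qk).
  exact: countable_bigcupT_measurable.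
apply/seteqP; split => [t Ut|t [qk _ [Bt]]]; last exact.
have [e e0 eU] : exists2 e : R, 0 < e & ball (of_coords t) e `<=` U.
  by have /nbhs_ballP[e e0 eU] := open_nbhs_nbhs (conj oU Ut); exists e.
(* Two radii must fit into [e]: one from the point to the rational centre, one from the centre to
   any other point of the cube. *)
have [k ke] : exists k, (k.+1%:R : R)^-1 < e / 2.
  have [k] := @ltr_add_invr R 0 (e / 2) (divr_gt0 e0 (ltr0n _ 2)).
  by rewrite add0r => ke; exists k.
have qP i : {q : rat | ball (ratr q : R) k.+1%:R^-1 (of_coords t 0 i)}.
  apply: cid.
  have k0 : (0 : R) < k.+1%:R^-1 by rewrite invr_gt0.
  have [] := @rat_in_itvoo R (of_coords t 0 i - k.+1%:R^-1)
    (of_coords t 0 i + k.+1%:R^-1).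
    by rewrite ltrBlDr -addrA ltrDl addr_gt0.
  move=> q; rewrite in_itv/= => /andP[q1 q2]; exists q.
  by rewrite /ball/= ltr_distl q1 q2.
pose q := [tuple sval (qP i) | i < d].
have Bqt : B (q, k) (of_coords t).
  by move=> i /=; rewrite tnth_mktuple; exact: (svalP (qP i)).
exists (q, k) => //; split=> // y By; apply: eU; split=> // a i.
rewrite ord1; move: (Bqt i) (By i) => /= /ball_sym tq qy.
have := ball_triangle tq qy; apply: le_ball.
by rewrite (splitr e) lerD// ltW.
Qed.

Lemma measurable_of_coords_continuous d (f : 'rV[R]_d -> R) : continuous f ->
  measurable_fun [set: d.-tuple (measurableTypeR R)] (f \o @of_coords R d).
Proof.
move=> cf; apply: (measurability _ (RGenOpens.measurableE R)).
move=> _ [_ [a [b ->]] <-].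
rewrite setTI comp_preimage; apply: measurable_of_coords_open.
apply: open_comp; last exact: interval_open.
by move=> x _; exact: cf.
Qed.

(** [Omega L] lives on tuples, so compactness is applied to the corresponding closed box [A] of row
    vectors. *)
Lemma Omega_bounded_continuous d (L : 'I_d -> R) (f : 'rV[R]_d -> R) :
  continuous f -> [bounded f (of_coords t) | t in Omega L].
Proof.
move=> cf.
pose A : set 'rV[R]_d := [set v | forall i, `[0, L i]%classic (v ord0 i)].
have cA : compact A.
  apply: (@rV_compact _ _ (fun i => `[0, L i]%classic)) => i.
  exact: segment_compact.
have cfA : compact (f @` A).
  by apply: continuous_compact cA; exact: continuous_subspaceT.
have [M [Mr MA]] := compact_bounded cfA.
exists M; split=> // x Mx t Lt /=; apply: MA => //; exists (of_coords t) => //.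
by move=> i /=; rewrite mxE in_itv/=; exact: Lt.
Qed.

Lemma Omega_integrable d (L : 'I_d -> R) (f : 'rV[R]_d -> R) : continuous f ->
  (lebesgue_tuple R d).-integrable (Omega L) (fun t => (f (of_coords t))%:E).
Proof.
move=> cf; apply: measurable_bounded_integrable.
- exact: measurable_Omega.
- exact: lebesgue_tuple_Omega_lty.
- by apply: measurable_funTS; exact: measurable_of_coords_continuous.
- exact: Omega_bounded_continuous.
Qed.

End box.

(** * Integrals of almost everywhere equal functions, without measurability *)

Section ae_equal_integrals.
Local Open Scope ereal_scope.
Context d (T : measurableType d) (R : realType).
Variable mu : {measure set T -> \bar R}.
Implicit Types f g : T -> \bar R.
Import HBNNSimple.

(** The integral is a supremum over simple functions below [f]. Cutting such a function to 0 on the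
    null set [N] puts it below [g] and keeps its integral. *)
Lemma ge0_le_integral_off_null (N : set T) f g : measurable N -> mu N = 0 ->
  (forall x, 0 <= f x) -> (forall x, 0 <= g x) ->
  (forall x, ~ N x -> f x <= g x) -> \int[mu]_x f x <= \int[mu]_x g x.
Proof.
move=> mN N0 f0 g0 fg; rewrite !ge0_integralTE//.
apply: ge_ereal_sup => _ [h hf <-].
apply: ereal_sup_ubound; exists (proj_nnsfun h (measurableC mN)).
  move=> x /=; rewrite mindicE; have [Nx|Nx] := pselect (N x).
    by rewrite memNset ?mulr0//=; exact.
  by rewrite mem_set// mulr1; exact: le_trans (hf x) (fg _ Nx).
have mh : measurable_fun [set: T] (EFin \o h) by exact/measurable_EFinP.
have h0 x : [set: T] x -> 0 <= (EFin \o h) x by rewrite lee_fin.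
have := ge0_negligible_integral mN measurableT mh h0 N0.
rewrite setTD !integral_nnsfun ?patch_setT => [->||]//; last exact: measurableC.
by rewrite (mrestrict _ (measurableC mN)).
Qed.

(** Meant for integrands containing [Zop], which divides by a gradient that may vanish and is not
    known to be measurable. The positive and negative parts are compared in both directions. *)
Lemma ae_eq_integral_nonmeasurable (D : set T) f g :
  {ae mu, forall x, D x -> f x = g x} ->
  \int[mu]_(x in D) f x = \int[mu]_(x in D) g x.
Proof.
move=> [N [mN N0 fgN]].
have fg x : ~ N x -> (f \_ D) x = (g \_ D) x.
  move=> Nx; rewrite !patchE; case: ifPn => //; rewrite inE => Dx.
  by apply: contrapT => fgx; apply/Nx/fgN => /= /(_ Dx).
rewrite integral_mkcond [RHS]integral_mkcond integralE [RHS]integralE.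
by congr (_ - _); apply/eqP; rewrite eq_le; apply/andP; split;
  apply: (ge0_le_integral_off_null mN N0) => // x /fg;
  rewrite ?funeposE ?funenegE => ->.
Qed.

End ae_equal_integrals.

(** * Divergence theorem on the periodic box *)

Section box_fubini.
Context (R : realType) (n : nat).
Local Open Scope ereal_scope.
Implicit Types (g : 'rV[R]_n.+1 -> R) (L : 'I_n.+1 -> R).

Let tailL L : 'I_n -> R := fun j => L (lift ord0 j).

(** The integrand is extended by 0 outside the box, so that Fubini can be applied on the whole
    product space. *)
Lemma Omega_prod_integrable L g : continuous g ->
  (@lebesgue_measure R \x lebesgue_tuple R n).-integrable setT
    ((fun p => (g (row_cons p.1 (of_coords p.2)))%:E)
       \_ (`[0%R, L ord0]%classic `*` Omega (tailL L))).
Proof.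
move=> cg.
have mbox : measurable (`[0%R, L ord0]%classic `*` Omega (tailL L)
    : set (measurableTypeR R * n.-tuple (measurableTypeR R))).
  by apply: measurableX; [exact: (measurable_itv `[0%R, L ord0])
                         |exact: measurable_Omega].
apply/(integrable_mkcond _ mbox).
pose h (p : measurableTypeR R * n.-tuple (measurableTypeR R)) :=
  g (row_cons p.1 (of_coords p.2)).
apply: (@measurable_bounded_integrable _ _ R
  (@lebesgue_measure R \x lebesgue_tuple R n) h _ mbox).
- rewrite [X in X < _](_ : _ = @lebesgue_measure R `[0%R, L ord0]%classic *
      lebesgue_tuple R n (Omega (tailL L))); last first.
    by apply: product_measure1E; [exact: (measurable_itv `[0%R, L ord0])
                                 |exact: measurable_Omega].
  rewrite lte_mul_pinfty//.
  + by rewrite /= lebesgue_measure_itv/=; case: ifP.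
  + exact: lebesgue_tuple_Omega_lty.
- apply: measurable_funTS.
  rewrite (_ : h = (g \o @of_coords R n.+1) \o @cons_pair R n).
    apply: measurableT_comp; first exact: measurable_of_coords_continuous.
    exact: measurable_cons_pair.
  by apply/funext => p /=; rewrite /h /cons_pair of_coords_cons.
- have [M [Mr MA]] := Omega_bounded_continuous L cg.
  exists M; split=> // x Mx p Lp /=.
  have := MA x Mx (cons_pair p); rewrite /= of_coords_cons; apply.
  by have : (@cons_pair R n @^-1` Omega L) p by rewrite cons_preimage_Omega.
Qed.

Lemma Omega_integral_prod L g : continuous g ->
  \int[lebesgue_tuple R n.+1]_(t in Omega L) (g (of_coords t))%:E =
  \int[@lebesgue_measure R \x lebesgue_tuple R n]_p
    ((fun p => (g (row_cons p.1 (of_coords p.2)))%:E)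
       \_ (`[0%R, L ord0]%classic `*` Omega (tailL L))) p.
Proof.
move=> cg; rewrite -integral_mkcond -cons_preimage_Omega.
rewrite [LHS](@integral_pushforward _ _ _ _ R (@cons_pair R n) _
  (@lebesgue_measure R \x lebesgue_tuple R n)%E)//.
- by apply: eq_integral => p _ /=; rewrite of_coords_cons.
- exact: measurable_cons_pair.
- apply/measurable_EFinP; exact: measurable_of_coords_continuous.
- rewrite cons_preimage_Omega.
  apply/integrable_mkcond; last first.
    rewrite (_ : _ \_ _ = ((fun p => (g (row_cons p.1 (of_coords p.2)))%:E)
       \_ (`[0%R, L ord0]%classic `*` Omega (tailL L)))).
      exact: Omega_prod_integrable.
    by congr (_ \_ _); apply/funext => p /=; rewrite of_coords_cons.
  by apply: measurableX; [exact: (measurable_itv `[0%R, L ord0])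
                         |exact: measurable_Omega].
- exact: measurable_Omega.
Qed.

(** Fubini with the first coordinate integrated innermost; slices over tails outside the box vanish
    by the extension by 0. *)
Lemma Omega_integral_head0 L g : continuous g ->
  (forall s, \int[@lebesgue_measure R]_(x in `[0%R, L ord0])
      (g (row_cons x (of_coords s)))%:E = 0) ->
  \int[lebesgue_tuple R n.+1]_(t in Omega L) (g (of_coords t))%:E = 0.
Proof.
move=> cg g0; rewrite Omega_integral_prod//.
rewrite -integral21_prod_meas1; last exact: Omega_prod_integrable.
apply: integral0_eq => s _; rewrite /fubini_G.
have [Ls|Ls] := pselect (Omega (tailL L) s); last first.
  apply: integral0_eq => x _; rewrite patchE; case: ifPn => //.
  by rewrite inE => -[].
rewrite -[RHS](g0 s) [RHS]integral_mkcond; apply: eq_integral => x _.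
rewrite !patchE; congr (if _ then _ else _).
by apply/idP/idP; rewrite !inE => // -[].
Qed.

(** Fubini in the other order, with the first coordinate frozen; this drives the induction on the
    dimension. *)
Lemma Omega_integral_tail0 L g : continuous g ->
  (forall x, \int[lebesgue_tuple R n]_(s in Omega (tailL L))
      (g (row_cons x (of_coords s)))%:E = 0) ->
  \int[lebesgue_tuple R n.+1]_(t in Omega L) (g (of_coords t))%:E = 0.
Proof.
move=> cg g0; rewrite Omega_integral_prod//.
rewrite -integral12_prod_meas1; last exact: Omega_prod_integrable.
apply: integral0_eq => x _; rewrite /fubini_F.
have [Lx|Lx] := pselect (`[0%R, L ord0]%classic x); last first.
  apply: integral0_eq => s _; rewrite patchE; case: ifPn => //.
  by rewrite inE => -[].
rewrite -[RHS](g0 x) [RHS]integral_mkcond; apply: eq_integral => s _.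
rewrite !patchE; congr (if _ then _ else _).
by apply/idP/idP; rewrite !inE => // -[].
Qed.

End box_fubini.

(** * Integrals of partial derivatives of periodic fields *)

Section box_divergence.
Context (R : realType).

(** The two difference quotients are the same function of [h], so the propositions are equal, and
    likewise for the three lemmas that follow. *)
Lemma derivable_row_cons_tail n (f : 'rV[R]_n.+1 -> R) x v (j : 'I_n) :
  derivable (f \o row_cons x) v (delta_mx 0 j) =
  derivable f (row_cons x v) (delta_mx 0 (lift ord0 j)).
Proof.
rewrite /derivable; set g1 := fun h => h^-1 *: _; set g2 := fun h => h^-1 *: _.
suff -> : g1 = g2 by []; apply/funext => h.
rewrite /g1/g2/=.
by rewrite row_cons_shift_tail.
Qed.

Lemma pderiv_row_cons_tail n (f : 'rV[R]_n.+1 -> R) x v (j : 'I_n) :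
  pderiv j (f \o row_cons x) v = pderiv (lift ord0 j) f (row_cons x v).
Proof.
rewrite /pderiv /derive.
set g1 := fun h => h^-1 *: _; set g2 := fun h => h^-1 *: _.
suff -> : g1 = g2 by []; apply/funext => h.
rewrite /g1/g2/=.
by rewrite row_cons_shift_tail.
Qed.

Lemma derivable_row_cons_head n (f : 'rV[R]_n.+1 -> R) x v :
  derivable (fun y => f (row_cons y v)) x 1 =
  derivable f (row_cons x v) (delta_mx 0 ord0).
Proof.
rewrite /derivable; set g1 := fun h => h^-1 *: _; set g2 := fun h => h^-1 *: _.
suff -> : g1 = g2 by []; apply/funext => h.
rewrite /g1/g2/=.
by rewrite -row_cons_shift_head [h *: 1]mulr1.
Qed.

Lemma derive1_row_cons_head n (f : 'rV[R]_n.+1 -> R) x v :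
  derive1 (fun y => f (row_cons y v)) x = pderiv ord0 f (row_cons x v).
Proof.
rewrite derive1E /pderiv /derive.
set g1 := fun h => h^-1 *: _; set g2 := fun h => h^-1 *: _.
suff -> : g1 = g2 by []; apply/funext => h.
rewrite /g1/g2/=.
by rewrite -row_cons_shift_head [h *: 1]mulr1.
Qed.

(** On each line along the first axis the fundamental theorem of calculus gives the difference of
    two boundary values that periodicity makes equal. *)
Lemma Omega_integral_pderiv_head n (L : 'I_n.+1 -> R) (f : 'rV[R]_n.+1 -> R) :
  0 < L ord0 -> (forall x, derivable f x (delta_mx 0 ord0)) ->
  continuous (pderiv ord0 f) ->
  (forall x, f (x + L ord0 *: delta_mx 0 ord0) = f x) ->
  (\int[lebesgue_tuple R n.+1]_(t in Omega L)
    (pderiv ord0 f (of_coords t))%:E = 0)%E.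
Proof.
move=> L0 df cf pf; apply: Omega_integral_head0 => // s.
pose F y := f (row_cons y (of_coords s)).
have dF x : derivable F x 1 by rewrite derivable_row_cons_head.
have cF : continuous F.
  by move=> x; apply/differentiable_continuous/derivable1_diffP.
have cdF :
    continuous (pderiv ord0 f \o (fun y : R => row_cons y (of_coords s))).

  move=> x; apply: continuous_comp.
    exact: row_cons_head_continuous.
  exact: cf.
rewrite (@continuous_FTC2 R
  (fun y => pderiv ord0 f (row_cons y (of_coords s))) F _ _ L0).
- rewrite -EFinB /F; have -> : row_cons (L ord0) (of_coords s) =
      row_cons 0 (of_coords s) + L ord0 *: delta_mx 0 ord0.
    by rewrite addrC -row_cons_shift_head addr0.
  by rewrite pf subrr.
- by apply: continuous_subspaceT; exact: cdF.
- split => //.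
  + by apply: cvg_at_right_filter; exact: cF.
  + by apply: cvg_at_left_filter; exact: cF.
- by move=> x _; rewrite derive1_row_cons_head.
Qed.

(** Coordinates are frozen one at a time until the direction [i] becomes the first one. *)
Lemma Omega_integral_pderiv d (L : 'I_d -> R) i (f : 'rV[R]_d -> R) :
  0 < L i -> (forall x, derivable f x (delta_mx 0 i)) ->
  continuous (pderiv i f) ->
  (forall x, f (x + L i *: delta_mx 0 i) = f x) ->
  (\int[lebesgue_tuple R d]_(t in Omega L)
    (pderiv i f (of_coords t))%:E = 0)%E.
Proof.
elim: d L i f => [|n IH] L i f; first by case: i.
case: (unliftP ord0 i) => [j|] -> Li df cf pf; last first.
  exact: Omega_integral_pderiv_head.
apply: Omega_integral_tail0 => // x.
under eq_integral do rewrite -pderiv_row_cons_tail.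
apply: IH => //.
- by move=> v; rewrite derivable_row_cons_tail.
- rewrite (_ : pderiv j _ = pderiv (lift ord0 j) f \o row_cons x).
    move=> v; apply: continuous_comp; first exact: row_cons_continuous.
    exact: cf.
  by apply/funext => v; rewrite pderiv_row_cons_tail.
- by move=> v; rewrite /= addrC row_cons_shift_tail addrC pf.
Qed.

End box_divergence.

(** * Rules for partial derivatives and the classes C^k *)

Section partial_derivatives.
Context (R : realType) (d : nat).
Implicit Types (f g : 'rV[R]_d -> R) (x : 'rV[R]_d).

Lemma continuous_scale (a : R) f :
  continuous f -> continuous (fun x => a * f x).
Proof.
move=> cf x; apply: (@continuousM _ _ (cst a)); last exact: cf.
exact: cst_continuous.
Qed.

Lemma continuous_lin a b f g : continuous f -> continuous g ->
  continuous (fun x => a * f x + b * g x).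
Proof.
move=> cf cg x.
by apply: (@continuousD _ _ _ (fun x => a * f x)); exact: continuous_scale.
Qed.

Lemma continuous_mul f g : continuous f -> continuous g ->
  continuous (fun x => f x * g x).
Proof. by move=> cf cg x; apply: continuousM; [exact: cf|exact: cg]. Qed.

Lemma derivable_lin a b f g x v : derivable f x v -> derivable g x v ->
  derivable (fun x => a * f x + b * g x) x v.
Proof.
move=> df dg; apply: (@derivableD _ _ _ (a \*: f) (b \*: g));
exact: derivableZ.
Qed.

Lemma pderiv_lin a b f g i x :
  derivable f x (delta_mx 0 i) -> derivable g x (delta_mx 0 i) ->
  pderiv i (fun x => a * f x + b * g x) x = a * pderiv i f x + b * pderiv i g x.
Proof.
move=> df dg.
have := deriveD (derivableZ (k := a) df) (derivableZ (k := b) dg).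
by rewrite (deriveZ a df) (deriveZ b dg).
Qed.

Lemma pderiv_mul f g i x :
  derivable f x (delta_mx 0 i) -> derivable g x (delta_mx 0 i) ->
  pderiv i (fun x => f x * g x) x = f x * pderiv i g x + pderiv i f x * g x.
Proof.
move=> df dg; have := deriveM df dg.
by rewrite [X in _ = _ + X]mulrC.
Qed.

Lemma of_class_C_continuous k f : of_class_C k f -> continuous f.
Proof. by case: k => [|k] // []. Qed.

Lemma of_class_C_derivable k f i x :
  of_class_C k.+1 f -> derivable f x (delta_mx 0 i).
Proof. by move=> [_ /(_ i)[]]. Qed.

Lemma of_class_C_pderiv k f i : of_class_C k.+1 f -> of_class_C k (pderiv i f).
Proof. by move=> [_ /(_ i)[]]. Qed.

Lemma of_class_CW k f : of_class_C k.+1 f -> of_class_C k f.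
Proof.
elim: k f => [f []//|k IH f [cf Cf]]; split=> // i.
by have [df Cdf] := Cf i; split=> //; exact: IH.
Qed.

Lemma of_class_C_lin k a b f g : of_class_C k f -> of_class_C k g ->
  of_class_C k (fun x => a * f x + b * g x).
Proof.
elim: k f g => [|k IH] f g; first exact: continuous_lin.
move=> [cf Cf] [cg Cg]; split; first exact: continuous_lin.
move=> i; have [df Cdf] := Cf i; have [dg Cdg] := Cg i; split.
  by move=> x; exact: derivable_lin.
have -> : pderiv i (fun x => a * f x + b * g x) =
    (fun x => a * pderiv i f x + b * pderiv i g x).
  by apply/funext => x; exact: pderiv_lin.
exact: IH.
Qed.

Lemma of_class_C_sum k (F : 'I_d -> 'rV[R]_d -> R) :
  (forall i, of_class_C k (F i)) -> of_class_C k (fun x => \sum_i F i x).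
Proof.
move=> CF.
suff : forall r : seq 'I_d, of_class_C k (fun x => \sum_(i <- r) F i x).
  exact.
have C0 m : of_class_C m (fun=> 0 : R).
  elim: m => [|m IH]; first by move=> x; exact: cst_continuous.
  split=> [x|i]; first exact: cst_continuous.
  split=> [x|]; first exact: derivable_cst.
  rewrite (_ : pderiv i _ = (fun=> 0))//.
  by apply/funext => x; exact: derive_cst.
elim=> [|i r IH].
  by under eq_fun do rewrite big_nil.
under eq_fun do rewrite big_cons.
have -> : (fun x => F i x + \sum_(j <- r) F j x) =
    (fun x => 1 * F i x + 1 * \sum_(j <- r) F j x).
  by apply/funext => x; rewrite !mul1r.
exact: of_class_C_lin.
Qed.

Lemma lap_lin a b f g x : of_class_C 2 f -> of_class_C 2 g ->
  lap (fun x => a * f x + b * g x) x = a * lap f x + b * lap g x.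
Proof.
move=> Cf Cg; rewrite /lap !mulr_sumr -big_split/=; apply: eq_bigr => i _.
have -> : pderiv i (fun x => a * f x + b * g x) =
    (fun x => a * pderiv i f x + b * pderiv i g x).
  apply/funext => y.
  exact: (pderiv_lin a b (of_class_C_derivable Cf) (of_class_C_derivable Cg)).
apply: pderiv_lin.
  exact: (of_class_C_derivable (of_class_C_pderiv i Cf)).
exact: (of_class_C_derivable (of_class_C_pderiv i Cg)).
Qed.

Lemma of_class_C_lap k f : of_class_C k.+2 f -> of_class_C k (lap f).
Proof.
move=> Cf; apply: of_class_C_sum => i.
exact: (of_class_C_pderiv i (of_class_C_pderiv i Cf)).
Qed.

Lemma divg_scale_grad (a : R) f x : of_class_C 2 f ->
  divg (fun y => a *: grad f y) x = a * lap f x.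
Proof.
move=> Cf; rewrite /divg /lap mulr_sumr; apply: eq_bigr => i _.
rewrite (_ : (fun y => _) = a \*: pderiv i f).
  rewrite /pderiv deriveZ//.
  exact: (of_class_C_derivable (of_class_C_pderiv i Cf)).
by apply/funext => y; rewrite !mxE.
Qed.

End partial_derivatives.

Section periodic_fields.
Context (R : realType) (d : nat) (L : 'I_d -> R).
Implicit Types (f g : 'rV[R]_d -> R) (x : 'rV[R]_d).

Lemma box_periodic_lin a b f g : box_periodic L f -> box_periodic L g ->
  box_periodic L (fun x => a * f x + b * g x).
Proof. by move=> pf pg x i; rewrite pf pg. Qed.

Lemma box_periodic_pderiv i f : box_periodic L f -> box_periodic L (pderiv i f).
Proof.
move=> pf x j; rewrite /pderiv /derive.
set g1 := fun h => h^-1 *: _; set g2 := fun h => h^-1 *: _.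
suff -> : g1 = g2 by []; apply/funext => h.
by rewrite /g1 /g2/= addrA !pf.
Qed.

Lemma periodic_C_lin k a b f g : periodic_C L k f -> periodic_C L k g ->
  periodic_C L k (fun x => a * f x + b * g x).
Proof.
by move=> [? ?] [? ?]; split; [exact: of_class_C_lin|exact: box_periodic_lin].
Qed.

Lemma periodic_CW k f : periodic_C L k.+1 f -> periodic_C L k f.
Proof. by move=> [? ?]; split => //; exact: of_class_CW. Qed.

Lemma periodic_C_pderiv k i f :
  periodic_C L k.+1 f -> periodic_C L k (pderiv i f).
Proof.
by move=> [? ?]; split; [exact: of_class_C_pderiv|exact: box_periodic_pderiv].
Qed.

Lemma periodic_C_lap k f : periodic_C L k.+2 f -> periodic_C L k (lap f).
Proof.
move=> [Cf pf]; split; first exact: of_class_C_lap.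
move=> x j; rewrite /lap; apply: eq_bigr => i _.
by do 2 apply: box_periodic_pderiv.
Qed.

Lemma periodic_C_continuous k f : periodic_C L k f -> continuous f.
Proof. by move=> [/of_class_C_continuous]. Qed.

End periodic_fields.

(** * Linearity of the integral, Green's formula and quadratic inequalities *)

Section box_integral.
Context (R : realType) (d : nat) (L : 'I_d -> R).
Implicit Types (f g : 'rV[R]_d -> R) (x : 'rV[R]_d).
Local Notation I := (integral_Omega L).

Lemma eq_integral_Omega f g : f =1 g -> I f = I g.
Proof. by move=> /funext ->. Qed.

Lemma integral_Omega_lin a b f g : continuous f -> continuous g ->
  I (fun x => a * f x + b * g x) = a * I f + b * I g.
Proof.
move=> cf cg; have mO := measurable_Omega L.
have intZ (c : R) (h : 'rV[R]_d -> R) : continuous h ->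
    (lebesgue_tuple R d).-integrable (Omega L)
      (EFin \o (fun t => c * h (of_coords t))).
  move=> ch; apply: (Omega_integrable L (f := fun x => c * h x)).
  exact: continuous_scale.
rewrite /integral_Omega RintegralD//; [|exact: intZ..].
by rewrite !RintegralZl//; exact: Omega_integrable.
Qed.

Lemma integral_OmegaZ a f : continuous f -> I (fun x => a * f x) = a * I f.
Proof.
move=> cf; have := integral_Omega_lin a 0 cf cf; rewrite mul0r addr0 => <-.
by apply: eq_integral_Omega => x; rewrite mul0r addr0.
Qed.

Lemma integral_OmegaD f g : continuous f -> continuous g ->
  I (fun x => f x + g x) = I f + I g.
Proof.
move=> cf cg; rewrite -[I f]mul1r -[I g]mul1r -integral_Omega_lin//.
by apply: eq_integral_Omega => x; rewrite !mul1r.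
Qed.

Lemma integral_Omega_sum (F : 'I_d -> 'rV[R]_d -> R) :
  (forall i, continuous (F i)) -> I (fun x => \sum_i F i x) = \sum_i I (F i).
Proof.
move=> cF.
(* Continuity of the partial sums is carried along because additivity of the integral requires
   it. *)
suff : forall r : seq 'I_d, continuous (fun x => \sum_(i <- r) F i x) /\
    I (fun x => \sum_(i <- r) F i x) = \sum_(i <- r) I (F i).
  by move=> /(_ (index_enum _))[].
have C0 : continuous (fun _ : 'rV[R]_d => 0 : R).
  by move=> x; exact: cst_continuous.
elim=> [|i r [cr IH]].
  under eq_fun do rewrite big_nil; split; first exact: C0.
  rewrite big_nil; have := integral_OmegaZ 0 C0.
  by rewrite !mul0r.
under eq_fun do rewrite big_cons; split.
  by move=> x; apply: (@continuousD _ _ _ (F i)); [exact: cF|exact: cr].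
by rewrite integral_OmegaD// big_cons IH.
Qed.

Lemma integral_Omega_ge0 f : (forall x, 0 <= f x) -> 0 <= I f.
Proof. by move=> f0; apply: Rintegral_ge0 => t _. Qed.

Lemma le_integral_Omega f g : continuous f -> continuous g ->
  (forall x, f x <= g x) -> I f <= I g.
Proof.
move=> cf cg fg; apply: le_Rintegral => //; first exact: measurable_Omega.
- exact: Omega_integrable.
- exact: Omega_integrable.
Qed.

Lemma ae_eq_integral_Omega f g :
  ae_Omega L (fun x => f x = g x) -> I f = I g.
Proof.
move=> fg; rewrite /integral_Omega /Rintegral; congr fine.
apply: ae_eq_integral_nonmeasurable.
case: fg => N [mN N0 fgN]; exists N; split=> // t /= fgt; apply: fgN => /= fgt'.
by apply: fgt => /fgt' ->.
Qed.

Hypothesis L_gt0 : forall i, 0 < L i.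

Lemma integral_Omega_pderiv i f : periodic_C L 1 f -> I (pderiv i f) = 0.
Proof.
move=> [Cf pf]; rewrite /integral_Omega /Rintegral Omega_integral_pderiv//.
- by move=> x; exact: (of_class_C_derivable Cf).
- exact: (of_class_C_continuous (of_class_C_pderiv i Cf)).
Qed.

Lemma integral_Omega_lap f : periodic_C L 2 f -> I (lap f) = 0.
Proof.
move=> pf; rewrite integral_Omega_sum => [|i].
  by apply: big1 => i _; apply: integral_Omega_pderiv; exact: periodic_C_pderiv.
by apply: (@periodic_C_continuous _ _ L 0); do 2 apply: periodic_C_pderiv.
Qed.

(** The polar form of the squared [L2norm_grad]. Evaluated at images under [invlap], it is also the
    H^{-1} inner product. *)
Definition dirichlet f g := \sum_i I (fun x => pderiv i f x * pderiv i g x).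

Lemma dirichletC f g : dirichlet f g = dirichlet g f.
Proof.
apply: eq_bigr => i _; apply: eq_integral_Omega => x; exact: mulrC.
Qed.

(** For each [i] the product [f * pderiv i g] is periodic, so its [i]-th derivative integrates to 0;
    the product rule splits that derivative into the two integrands. *)
Lemma green f g : periodic_C L 1 f -> periodic_C L 2 g ->
  I (fun x => f x * lap g x) = - dirichlet f g.
Proof.
move=> pf pg.
have cf := periodic_C_continuous pf.
have pdg i := periodic_C_pderiv i pg.
have cdf i : continuous (pderiv i f).
  exact: (periodic_C_continuous (periodic_C_pderiv i pf)).
have cdg i : continuous (pderiv i g) by exact: (periodic_C_continuous (pdg i)).
have cddg i : continuous (pderiv i (pderiv i g)).
  exact: (periodic_C_continuous (periodic_C_pderiv i (pdg i))).
under eq_fun do rewrite /lap mulr_sumr.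
rewrite integral_Omega_sum => [|i]; last exact: continuous_mul.
rewrite /dirichlet -sumrN; apply: eq_bigr => i _; apply/eqP.
rewrite -addr_eq0 -integral_OmegaD; [|exact: continuous_mul..]; apply/eqP.
have dE x : pderiv i (fun x => f x * pderiv i g x) x =
    f x * pderiv i (pderiv i g) x + pderiv i f x * pderiv i g x.
  apply: pderiv_mul; [exact: (of_class_C_derivable pf.1)|].
  exact: (of_class_C_derivable (pdg i).1).
rewrite -(eq_integral_Omega dE) /integral_Omega /Rintegral.
rewrite Omega_integral_pderiv//.
- move=> x; apply: derivableM; [exact: (of_class_C_derivable pf.1)|].
  exact: (of_class_C_derivable (pdg i).1).
- have -> : pderiv i (fun x => f x * pderiv i g x) =
      (fun x => 1 * (f x * pderiv i (pderiv i g) x) +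
                1 * (pderiv i f x * pderiv i g x)).
    by apply/funext => x; rewrite dE !mul1r.
  exact: (continuous_lin (continuous_mul cf (cddg i))
                         (continuous_mul (cdf i) (cdg i))).
- by move=> x; rewrite pf.2 (pdg i).2.
Qed.

Lemma green_sym f g : periodic_C L 2 f -> periodic_C L 2 g ->
  I (fun x => lap f x * g x) = I (fun x => f x * lap g x).
Proof.
move=> pf pg; rewrite green//; last exact: periodic_CW.
rewrite dirichletC -green//; last exact: periodic_CW.
by apply: eq_integral_Omega => x; rewrite mulrC.
Qed.

(** The square of [s * pderiv i f - pderiv i g] is nonnegative. The weight [s] stays free until the
    step ratio fixes it. *)
Lemma dirichlet_young (s : R) f g : periodic_C L 1 f -> periodic_C L 1 g ->
  2 * s * dirichlet f g <= s ^+ 2 * dirichlet f f + dirichlet g g.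
Proof.
move=> pf pg; rewrite /dirichlet !mulr_sumr -big_split/=.
apply: ler_sum => i _.
have cdf := periodic_C_continuous (periodic_C_pderiv i pf).
have cdg := periodic_C_continuous (periodic_C_pderiv i pg).
rewrite -[X in _ + X]mul1r -integral_Omega_lin; [|exact: continuous_mul..].
rewrite -integral_OmegaZ; last exact: continuous_mul.
apply: le_integral_Omega => [| |x].
- exact/continuous_scale/continuous_mul.
- by apply: continuous_lin; exact: continuous_mul.
- have := sqr_ge0 (s * pderiv i f x - pderiv i g x); nra.
Qed.

Lemma dirichlet_ge0 f : 0 <= dirichlet f f.
Proof.
apply: sumr_ge0 => i _; apply: integral_Omega_ge0 => x; exact: sqr_ge0.
Qed.

(* [(theta p + (1 - theta) q) (p - q) =
    (p^2 - q^2) / 2 + (theta - 1/2) (p - q)^2] *)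
Lemma theta_step_ge theta (p q : 'rV[R]_d -> R) :
  2^-1 <= theta -> continuous p -> continuous q ->
  2^-1 * (I (fun x => p x ^+ 2) - I (fun x => q x ^+ 2)) <=
  I (fun x => (theta * p x + (1 - theta) * q x) * (p x - q x)).
Proof.
move=> theta2 cp cq.
rewrite mulrBr -mulNr -integral_Omega_lin; [|exact: continuous_mul..].
have cpq : continuous (fun x => p x - q x).
  by move=> x; apply: (@continuousB _ _ _ p q); [exact: cp|exact: cq].
apply: le_integral_Omega => [| |x].
- by apply: continuous_lin; exact: continuous_mul.
- by apply: continuous_mul cpq; exact: continuous_lin.
- have : 0 <= (theta - 2^-1) * (p x - q x) ^+ 2.
    by rewrite mulr_ge0 ?sqr_ge0// subr_ge0.
  nra.
Qed.

Lemma L2normE f : L2norm L f ^+ 2 = I (fun x => f x ^+ 2).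
Proof. by rewrite sqr_sqrtr// integral_Omega_ge0// => x; exact: sqr_ge0. Qed.

Lemma L2norm_gradE f : periodic_C L 1 f -> L2norm_grad L f ^+ 2 = dirichlet f f.
Proof.
move=> pf; rewrite /L2norm_grad L2normE /dirichlet -integral_Omega_sum.
  apply: eq_integral_Omega => x; rewrite sqr_sqrtr; last first.
    by apply: sumr_ge0 => i _; exact: sqr_ge0.
  by apply: eq_bigr => i _; rewrite mxE.
move=> i; have := periodic_C_continuous (periodic_C_pderiv i pf).
by move=> c; exact: continuous_mul.
Qed.

End box_integral.

(** * Time stepping *)

Section step_inequality.
Context (R : realType).
Implicit Types theta g s : R.

(* [g], [g'] and [s] are the square roots of two step ratios and of gamma_*. *)
Lemma gamma_star_ratio_bound theta g g' s :
  2^-1 <= theta <= 1 -> 0 <= s ->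
  (2 * theta - 1) * s ^+ 3 = 2 * theta * s ^+ 2 + 1 ->
  0 <= g <= s -> 0 <= g' <= s ->
  (2 * theta - 1) * g' ^+ 3 / (1 + g' ^+ 2) <=
  (2 + 4 * theta * g ^+ 2 - (2 * theta - 1) * g ^+ 3) / (1 + g ^+ 2).
Proof.
move=> /andP[t1 t2] s0 sE /andP[g0 gs] /andP[g'0 g's].
have p0 : 0 <= 2 * theta - 1 by lra.
(* The intermediate value is the one both sides take at [g = g' = s], by [sE]. *)
apply: (@le_trans _ _ ((2 * theta * s ^+ 2 + 1) / (1 + s ^+ 2))).
  rewrite ler_pdivrMr; last by nra.
  rewrite mulrAC ler_pdivlMr; last by nra.
  rewrite -sE -!mulrA ler_wpM2l//.
  (* Monotonicity of [x^3 / (1 + x^2)]: after cross-multiplication the difference is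
     [(s^3 - g'^3) + s^2 g'^2 (s - g')]. *)
  have : 0 <= (s - g') * (s ^+ 2 + s * g' + g' ^+ 2).
    by rewrite mulr_ge0 ?subr_ge0// !addr_ge0 ?mulr_ge0 ?sqr_ge0.
  have : 0 <= s ^+ 2 * g' ^+ 2 * (s - g').
    by rewrite mulr_ge0 ?subr_ge0// mulr_ge0 ?sqr_ge0.
  by nra.
rewrite ler_pdivlMr; last by nra.
rewrite mulrAC ler_pdivrMr; last by nra.
have s_gt0 : 0 < s.
  rewrite lt0r s0 andbT; apply/negP => /eqP s00.
  by move: sE; rewrite s00 !expr0n/=; lra.
(* [q] is the step ratio as a fraction of gamma_*. Since [g <= s], the cubic term is at most
   [q (2 theta s^2 + 1)]; with this bound the gap between the two sides is exactly the product in
   [c3]. *)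
pose q := g ^+ 2 / s ^+ 2.
have gE : g ^+ 2 = q * s ^+ 2 by rewrite /q divfK// sqrf_eq0 gt_eqF.
have q1 : q <= 1 by rewrite /q ler_pdivrMr ?exprn_gt0// mul1r lerXn2r.
have sqE : (2 * theta - 1) * (s * g ^+ 2) = q * (2 * theta * s ^+ 2 + 1).
  by rewrite -sE gE; ring.
have c2 : (2 * theta - 1) * g ^+ 3 <= q * (2 * theta * s ^+ 2 + 1).
  by rewrite -sqE ler_wpM2l// exprS ler_wpM2r// sqr_ge0.
have c3 : 0 <= (1 - q) * (1 + 2 * (1 - theta) * s ^+ 2).
  rewrite mulr_ge0 ?subr_ge0// addr_ge0// mulr_ge0 ?sqr_ge0//.
  by rewrite mulr_ge0 ?subr_ge0.
have c4 : (2 * theta - 1) * g ^+ 3 * (1 + s ^+ 2) <=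
    q * (2 * theta * s ^+ 2 + 1) * (1 + s ^+ 2).
  by rewrite ler_wpM2r// addr_ge0 ?sqr_ge0.
rewrite gE; nra.
Qed.
End step_inequality.

Section step_estimates.
Context (R : realType).

Lemma powR_three_halves (x : R) : 0 <= x -> x `^ (3 / 2) = Num.sqrt x ^+ 3.
Proof.
move=> x0; rewrite mulrC powRrM powR12_sqrt//.
by rewrite -[3]/(3%:R) powR_mulrn ?sqrtr_ge0.
Qed.

Lemma gamma_star_step (theta g g' : R) (gs : \bar R) :
  2^-1 <= theta <= 1 -> is_gamma_star theta gs ->
  0 <= g -> (g%:E <= gs)%E -> 0 <= g' -> (g'%:E <= gs)%E ->
  (2 * theta - 1) * g' `^ (3 / 2) / (1 + g') <=
  (2 + 4 * theta * g - (2 * theta - 1) * g `^ (3 / 2)) / (1 + g).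
Proof.
move=> thetaP [_ gsP] g0 ggs g'0 g'gs; rewrite !powR_three_halves//.
(* At [theta = 1/2] both fractional powers have coefficient 0, and the claim is that a quotient of
   positive numbers is nonnegative. *)
have [->|/eqP /gsP[r [r0 rE gsE]]] := eqVneq theta 2^-1.
  rewrite divff ?pnatr_eq0// subrr !mul0r subr0 divr_ge0//; lra.
have /andP[t1 t2] := thetaP.
move: ggs g'gs; rewrite gsE !lee_fin => gr g'r.
have sqE (x : R) : 0 <= x -> Num.sqrt x ^+ 2 = x by move=> ?; rewrite sqr_sqrtr.
have := @gamma_star_ratio_bound R theta (Num.sqrt g) (Num.sqrt g') (Num.sqrt r).
rewrite !sqE ?(ltW r0)//; apply; rewrite ?sqrtr_ge0 ?ler_wsqrtr//.
(* The cubic says [(2 theta - 1)^2 r^3 = (2 theta r + 1)^2]; both bases are nonnegative, so the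
   square roots agree. *)
apply/eqP; rewrite -(@eqrXn2 _ 2)//.
- rewrite exprMn -exprM mulnC exprM sqE ?ltW//; apply/eqP; nra.
- by rewrite mulr_ge0 ?exprn_ge0 ?sqrtr_ge0//; lra.
- by rewrite addr_ge0// mulr_ge0 ?ltW//; lra.
Qed.

(* [X] stands for an inner product of two vectors of square norms [H1] and
   [H0]; Young's inequality is applied to it with weight [g^(-1/2)]. *)
Lemma variable_step_dissipation (theta g g' tau1 tau0 H1 H0 X : R)
    (gs : \bar R) : 2^-1 <= theta <= 1 -> is_gamma_star theta gs ->
  0 < g -> (g%:E <= gs)%E -> 0 <= g' -> (g'%:E <= gs)%E ->
  0 < tau0 -> tau1 = g * tau0 -> 0 <= H1 ->
  (forall s, 2 * s * X <= s ^+ 2 * H1 + H0) ->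
  (2 * theta - 1) * g' `^ (3 / 2) / (2 * (1 + g')) * (H1 / tau1) -
  (2 * theta - 1) * g `^ (3 / 2) / (2 * (1 + g)) * (H0 / tau0) <=
  (1 + 2 * theta * g) / (tau1 * (1 + g)) * H1 +
  (1 - 2 * theta) * g ^+ 2 / (tau1 * (1 + g)) * X.
Proof.
move=> thetaP gsP g_gt0 ggs g'0 g'gs tau0_gt0 -> H1_ge0 young.
have := gamma_star_step thetaP gsP (ltW g_gt0) ggs g'0 g'gs.
have /andP[t1 t2] := thetaP.
rewrite (powR_three_halves (ltW g_gt0)).
set G' := g' `^ _; set h := Num.sqrt g.
have h_gt0 : 0 < h by rewrite sqrtr_gt0.
have gE : g = h ^+ 2 by rewrite sqr_sqrtr// ltW.
rewrite gE => gsI.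
have hn : h != 0 by rewrite gt_eqF.
(* Young's inequality at [s = 1/h], multiplied by [h]. *)
have X_le : 2 * X <= H1 / h + h * H0.
  have := ler_wpM2l (ltW h_gt0) (young h^-1).
  have -> : h * (2 * h^-1 * X) = 2 * X by field.
  by have -> : h * (h^-1 ^+ 2 * H1 + H0) = H1 / h + h * H0 by field.
(* Half the absolute value of the coefficient of [X], which is nonpositive. *)
have c_ge0 : 0 <= (2 * theta - 1) * h ^+ 4 / (h ^+ 2 * tau0 * (1 + h ^+ 2)) / 2.
  have hp : 0 < h ^+ 2 * tau0 * (1 + h ^+ 2).
    by rewrite !mulr_gt0 ?exprn_gt0// addr_gt0// exprn_gt0.
  have ? : 0 <= 2 * theta - 1 by lra.
  by rewrite divr_ge0// divr_ge0 ?(ltW hp)// mulr_ge0// exprn_ge0// ltW.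
have h2n : 1 + h ^+ 2 != 0 by rewrite gt_eqF// addr_gt0// exprn_gt0.
have g'n : 1 + g' != 0 by rewrite gt_eqF// ltr_wpDr.
have tn : tau0 != 0 by rewrite gt_eqF.
have m1 := ler_wpM2l c_ge0 X_le.
have k_ge0 : 0 <= H1 / (h ^+ 2 * tau0) / 2.
  by rewrite divr_ge0// divr_ge0// mulr_ge0 ?exprn_ge0// ltW.
have m2 := ler_wpM2l k_ge0 gsI.
(* The sum of the two gaps is exactly the gap of the goal: the [H1 / h] term of [m1] cancels the
   [(2 theta - 1) h^3] term of [m2]. *)
rewrite -subr_ge0 in m1; rewrite -subr_ge0 in m2.
rewrite -subr_ge0; have := addr_ge0 m1 m2.
congr (0 <= _); field; rewrite ?h2n ?g'n ?tn ?hn//.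
Qed.

End step_estimates.

(** * Theta-averages of the three quadratic forms *)

Section theta_energy_steps.
Context (R : realType) (d : nat) (L : 'I_d -> R) (theta : R).
Hypothesis L_gt0 : forall i, 0 < L i.
Hypothesis theta_ge : 2^-1 <= theta.
Variables p q : 'rV[R]_d -> R.
Hypotheses (pp : periodic_C L 4 p) (pq : periodic_C L 4 q).
Local Notation I := (integral_Omega L).
Local Notation psi := (fun x => theta * p x + (1 - theta) * q x).
Local Notation delta := (fun x => p x - q x).

Lemma periodic_C_sub k f g : periodic_C L k f -> periodic_C L k g ->
  periodic_C L k (fun x => f x - g x).
Proof.
move=> pf pg; have := periodic_C_lin 1 (- 1) pf pg.
by congr periodic_C; apply/funext => x; rewrite mul1r mulN1r.
Qed.

Lemma mass_theta_step :
  2^-1 * (L2norm L p ^+ 2 - L2norm L q ^+ 2) <= I (fun x => psi x * delta x).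
Proof.
rewrite !L2normE; apply: theta_step_ge => //.
- exact: (periodic_C_continuous pp).
- exact: (periodic_C_continuous pq).
Qed.

Let C2 f : periodic_C L 4 f -> periodic_C L 2 f.
Proof. by move=> pf; do 2 apply: periodic_CW. Qed.

(** Green's formula reduces the claim to [theta_step_ge] for each partial derivative. *)
Lemma gradient_theta_step :
  2^-1 * (L2norm_grad L p ^+ 2 - L2norm_grad L q ^+ 2) <=
  - I (fun x => lap psi x * delta x).
Proof.
have [p2 q2] := (C2 pp, C2 pq).
have [p1 q1] := (periodic_CW p2, periodic_CW q2).
have -> : L2norm_grad L p ^+ 2 - L2norm_grad L q ^+ 2 =
    dirichlet L p p - dirichlet L q q.
  by congr (_ - _); [exact: L2norm_gradE p1|exact: L2norm_gradE q1].
have -> : I (fun x => lap psi x * delta x) = I (fun x => delta x * lap psi x).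
  by apply: eq_integral_Omega => x; exact: mulrC.
rewrite (green L_gt0 (periodic_C_sub p1 q1)
  (periodic_C_lin theta (1 - theta) p2 q2)).
rewrite opprK /dirichlet -sumrB mulr_sumr; apply: ler_sum => i _.
apply: le_trans (theta_step_ge L theta_ge
  (periodic_C_continuous (periodic_C_pderiv i p1))
  (periodic_C_continuous (periodic_C_pderiv i q1))) _.
rewrite le_eqVlt; apply/orP; left; apply/eqP; apply: eq_integral_Omega => x.
have dp := of_class_C_derivable (i := i) (x := x) p1.1.
have dq := of_class_C_derivable (i := i) (x := x) q1.1.
rewrite (pderiv_lin theta (1 - theta) dp dq) mulrC; congr (_ * _).
have := pderiv_lin 1 (- 1) dp dq; rewrite mul1r mulN1r => <-.
by congr (pderiv i _ x); apply/funext => y; rewrite mul1r mulN1r.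
Qed.

(** One Laplacian is moved onto the increment, then [theta_step_ge] applies to [lap p] and
    [lap q]. *)
Lemma laplacian_theta_step :
  2^-1 * (L2norm L (lap p) ^+ 2 - L2norm L (lap q) ^+ 2) <=
  I (fun x => lap (lap psi) x * delta x).
Proof.
have pd := C2 (periodic_C_sub pp pq).
have ppsi := periodic_C_lap (periodic_C_lin theta (1 - theta) pp pq).
have [Cp Cq] := ((C2 pp).1, (C2 pq).1).
rewrite (green_sym L_gt0 ppsi pd).
have -> : L2norm L (lap p) ^+ 2 - L2norm L (lap q) ^+ 2 =
    I (fun x => lap p x ^+ 2) - I (fun x => lap q x ^+ 2).
  by congr (_ - _); exact: L2normE.
apply: le_trans (theta_step_ge L theta_ge
  (periodic_C_continuous (periodic_C_lap pp))
  (periodic_C_continuous (periodic_C_lap pq))) _.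
rewrite le_eqVlt; apply/orP; left; apply/eqP; apply: eq_integral_Omega => x.
rewrite (lap_lin theta (1 - theta) x Cp Cq); congr (_ * _).
have := lap_lin 1 (- 1) x Cp Cq; rewrite mul1r mulN1r => <-.
by congr (lap _ x); apply/funext => y; rewrite mul1r mulN1r.
Qed.

End theta_energy_steps.

(** * Elimination of the nonlinear term *)

Section auxiliary_variable.
Context (R : realType) (d : nat) (L : 'I_d -> R).
Local Notation I := (integral_Omega L).

(* [Z] is a.e. equal to a continuous function only when [u1 != 0]: otherwise
   its coefficient in the second equation vanishes and [I (Z * delta)] may be a
   junk value, but it is then multiplied by [u1]. *)
Lemma auxiliary_variable_step (mu Q Z delta : 'rV[R]_d -> R)
    (u1 u0 s v tau : R) :
  continuous mu -> continuous Q -> continuous delta ->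
  0 < s -> 0 < v -> 0 < tau ->
  ae_Omega L (fun x => mu x = u1 / s * v * Z x + Q x) ->
  (u1 - u0) / tau = v / (2 * s) * I (fun x => Z x * (delta x / tau)) ->
  I (fun x => mu x * delta x) =
  2 * u1 * (u1 - u0) + I (fun x => Q x * delta x).
Proof.
move=> cmu cQ cdelta s_gt0 v_gt0 tau_gt0 muE uE.
have [u10|u1_neq0] := eqVneq u1 0.
  rewrite u10 mulr0 mul0r add0r; apply: ae_eq_integral_Omega.
  case: muE => N [mN N0 sN]; exists N; split=> // t /= h; apply: sN => /= e.
  by apply: h => /e; rewrite u10 !mul0r add0r => ->.
pose c := u1 / s * v.
have c_neq0 : c != 0 by rewrite /c !mulf_eq0 invr_eq0 (negPf u1_neq0) !gt_eqF.
(* Almost everywhere [Z] equals the continuous field [(mu - Q) / c], for which the integral is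
   linear. *)
have ZE : I (fun x => Z x * (delta x / tau)) =
    (c * tau)^-1 * (I (fun x => mu x * delta x) - I (fun x => Q x * delta x)).
  have cmd := continuous_mul cmu cdelta; have cQd := continuous_mul cQ cdelta.
  rewrite mulrBr -mulNr -integral_Omega_lin//; apply: ae_eq_integral_Omega.
  case: muE => N [mN N0 sN]; exists N; split=> // t /= h; apply: sN => /= e.
  apply: h => /e ->; rewrite -/c; field.
  by rewrite c_neq0 gt_eqF.
apply/eqP; rewrite -subr_eq; apply/eqP.
have -> : u1 - u0 = (u1 - u0) / tau * tau by rewrite divfK// gt_eqF.
rewrite uE ZE /c; field.
by rewrite u1_neq0 !gt_eqF.
Qed.

End auxiliary_variable.

(** * The H^{-1} inner product *)

Section inverse_laplacian.
Context (R : realType) (d : nat) (L : 'I_d -> R).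
Hypothesis L_gt0 : forall i, 0 < L i.
Local Notation I := (integral_Omega L).
Variable invlap : ('rV[R]_d -> R) -> 'rV[R]_d -> R.
Hypothesis invlapP : is_inverse_laplacian L invlap.

(** Green's formula with both arguments equal to [invlap v], whose Laplacian is [v]. *)
Lemma Hm1_normsqE v : periodic_C L 4 v -> I v = 0 ->
  Hm1_normsq L invlap v = dirichlet L (invlap v) (invlap v).
Proof.
move=> pv v0; have [pw w0 wE] := invlapP pv v0.
apply: oppr_inj; rewrite -(green L_gt0 (periodic_CW pw) pw) /Hm1_normsq.
have cwv : continuous (fun x => invlap v x * v x).
  exact: continuous_mul (periodic_C_continuous pw) (periodic_C_continuous pv).
rewrite -mulN1r -integral_OmegaZ.
  by apply: eq_integral_Omega => x; rewrite wE mulN1r mulNr opprK.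
rewrite (_ : (fun x => _) = (fun x => - 1 * (invlap v x * v x))).
  exact: continuous_scale.
by apply/funext => x; rewrite mulN1r mulNr.
Qed.

Lemma integral_mul_invlap v v' : periodic_C L 4 v -> I v = 0 ->
  periodic_C L 4 v' -> I v' = 0 ->
  I (fun x => v' x * invlap v x) = - dirichlet L (invlap v) (invlap v').
Proof.
move=> pv v0 pv' v'0.
have [pw w0 wE] := invlapP pv v0; have [pw' w'0 w'E] := invlapP pv' v'0.
rewrite -(green L_gt0 (periodic_CW pw) pw').
by apply: eq_integral_Omega => x; rewrite w'E mulrC.
Qed.

(** Testing the diffusion term of the first equation with [invlap v] amounts to testing [mu] with
    [v], which links it to the second equation. *)
Lemma integral_lap_mul_invlap v mu : periodic_C L 4 v -> I v = 0 ->
  periodic_C L 2 mu ->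
  I (fun x => lap mu x * invlap v x) = I (fun x => mu x * v x).
Proof.
move=> pv v0 pmu; have [pw w0 wE] := invlapP pv v0.
rewrite (green_sym L_gt0 pmu pw).
by apply: eq_integral_Omega => x; rewrite wE.
Qed.

End inverse_laplacian.

(** The scalar bookkeeping: [S] is the tested time derivative, [J] the tested chemical potential,
    [W] its linear part, and [A], [B], [C] are the squared norms of the field, its gradient and its
    Laplacian. *)
Lemma energy_decrement (R : realType) (M l1 l2 l3 e2 K1 K0 H1 H0 D1 D0 t1 t0 S J
    u1 u0 W w1 w2 w3 A1 A0 B1 B0 C1 C0 : R) :
  0 < M -> 0 < l1 -> 0 < l2 -> 0 < l3 -> 0 < e2 -> H1 = D1 -> H0 = D0 ->
  K1 * (D1 / t1) - K0 * (D0 / t0) <= S -> M * J = - S ->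
  J = 2 * u1 * (u1 - u0) + W -> W = l1 / e2 * w1 - l2 * w2 + l3 * w3 ->
  2^-1 * (A1 - A0) <= w1 -> 2^-1 * (B1 - B0) <= - w2 ->
  2^-1 * (C1 - C0) <= w3 ->
  K1 * (H1 / (M * t1)) + l1 / (2 * e2) * A1 + l2 / 2 * B1 + l3 / 2 * C1
    + `|u1| ^+ 2 -
  (K0 * (H0 / (M * t0)) + l1 / (2 * e2) * A0 + l2 / 2 * B0 + l3 / 2 * C0
    + `|u0| ^+ 2) <= 0.
Proof.
move=> M0 l10 l20 l30 e20 -> -> dis MJ JE WE qA qB qC.
rewrite !real_normK ?num_real//.
have pA := ler_wpM2l (ltW (divr_gt0 l10 e20)) qA.
have pB := ler_wpM2l (ltW l20) qB.
have pC := ler_wpM2l (ltW l30) qC.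
have pS := ler_wpM2l (_ : 0 <= M^-1) dis; rewrite invr_ge0 ltW// in pS.
have SE : M^-1 * S = - J by rewrite -[S]opprK -MJ mulrN mulKf// gt_eqF.
(* [2 u1 (u1 - u0) = u1^2 - u0^2 + (u1 - u0)^2], and the last square is dropped. *)
have pU := sqr_ge0 (u1 - u0).
have {}pS : K1 * (D1 / (M * t1)) - K0 * (D0 / (M * t0)) <= - J.
  rewrite -SE; apply: le_trans (pS isT); rewrite le_eqVlt; apply/orP; left.
  by rewrite !invfM; apply/eqP; ring.
have -> : l1 / (2 * e2) = l1 / e2 / 2 by rewrite invfM [2^-1 * _]mulrC mulrA.
by move: pS; rewrite JE WE; lra.
Qed.

Theorem theorem4p3 (R : realType) (d : nat) (hd : d = 2%N \/ d = 3%N)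
  (L : 'I_d -> R) (hL : forall i, 0 < L i)
  (invlap : ('rV[R]_d -> R) -> 'rV[R]_d -> R)
  (hinvlap : is_inverse_laplacian L invlap)
  (theta eps alpha beta lam1 lam2 lam3 M C0 : R)
  (htheta : 2^-1 <= theta <= 1) (heps : 0 < eps) (halpha : 0 <= alpha)
  (hbeta : 0 < beta) (hlam1 : 0 < lam1) (hlam2 : 0 < lam2) (hlam3 : 0 < lam3)
  (hM : 0 < M) (hC0 : 0 < C0)
  (V : R -> R) (hVpos : forall s, 0 < V s)
  (hVderivable : forall s : R, derivable V s 1 /\ derivable (derive1 V) s 1)
  (hVC2 : continuous (derive1n 2 V : R -> R))
  (hV1 : V 1 = 1)
  (hVlim : (V s - 1) / (1 - s) @[s --> (1 : R)^'] --> (1 : R))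
  (N : nat) (T : R) (t : nat -> R)
  (ht0 : t 0%N = 0) (htN : t N = T)
  (htmesh : forall n, (n < N)%N -> t n < t n.+1)
  (gamma_star : \bar R) (hgamma_star : is_gamma_star theta gamma_star)
  (hratio : forall n, (1 <= n < N)%N ->
     0 <= step_ratio t n.+1 /\ ((step_ratio t n.+1)%:E <= gamma_star)%E)
  (phi mu : nat -> 'rV[R]_d -> R) (u : nat -> R)
  (hphi : forall n, (n <= N)%N -> periodic_C L 4 (phi n))
  (hmu : forall n, (1 <= n < N)%N -> periodic_C L 2 (mu n))
  (hE2 : forall n, (n <= N)%N ->
     0 < E2 L alpha beta eps lam1 lam2 lam3 C0 (phi n))
  (hmean : integral_Omega L (phi 1%N) = integral_Omega L (phi 0%N))
  (hscheme : forall n, (1 <= n < N)%N ->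
     let sqrtE2 := Num.sqrt (E2 L alpha beta eps lam1 lam2 lam3 C0 (phi n)) in
     let xi := u n.+1 / sqrtE2 in
     let Zstar := Zop alpha beta eps lam1 lam2 lam3 (extrap t theta phi n) in
     [/\ forall x, Dtheta t theta phi n x =
           divg (fun y => M *: grad (mu n) y) x,
         ae_Omega L (fun x => mu n x =
           u n.+1 / sqrtE2 * V xi * Zstar x
           + lam1 / eps ^+ 2 * interp theta phi n x
           - lam2 * lap (interp theta phi n) x
           + lam3 * lap (lap (interp theta phi n)) x)
       & (u n.+1 - u n) / tau t n.+1 =
           V xi / (2 * sqrtE2)
           * integral_Omega L (fun x =>
               Zstar x * ((phi n.+1 x - phi n x) / tau t n.+1))]) :
  forall n, (1 <= n)%N -> (n.+2 <= N)%N ->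
    modified_energy t theta L invlap M eps lam1 lam2 lam3 phi u n.+1
    - modified_energy t theta L invlap M eps lam1 lam2 lam3 phi u n <= 0.
Proof.
move=> n n_ge1 nN.
pose delta k x := phi k x - phi k.-1 x.
have tau_gt0 k : (0 < k <= N)%N -> 0 < tau t k.
  by case: k => // k /andP[_ kN]; rewrite /tau subr_gt0; exact: htmesh.
(* Strict positivity comes from the strictly increasing mesh; the Young weight divides by the root
   of the ratio. *)
have ratio_gt0 k : (0 < k < N)%N -> 0 < step_ratio t k.+1.
  move=> /andP[k0 kN]; rewrite divr_gt0 ?tau_gt0 ?k0//=; exact: ltnW.
have pdelta k : (k <= N)%N -> periodic_C L 4 (delta k).
  move=> kN; apply: periodic_C_sub; apply: hphi => //.
  exact: leq_trans (leq_pred k) kN.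
pose a k := (1 + 2 * theta * step_ratio t k.+1) /
  (tau t k.+1 * (1 + step_ratio t k.+1)).
pose b k := (1 - 2 * theta) * step_ratio t k.+1 ^+ 2 /
  (tau t k.+1 * (1 + step_ratio t k.+1)).
have evolution k x : (0 < k < N)%N ->
    a k * delta k.+1 x + b k * delta k x = M * lap (mu k) x.
  move=> kN; have [/(_ x) e _ _] := hscheme _ kN.
  by rewrite -(divg_scale_grad M x (hmu _ kN).1) -e.
(* Mass conservation, by induction. [delta 0] is 0 because [0.-1 = 0], and [delta 1] is covered by
   [hmean]. Beyond that, integrating [evolution] kills the Laplacian and leaves [a k] times the new
   mean equal to 0, with [a k > 0]. *)
have delta0 k : (k <= N)%N -> integral_Omega L (delta k) = 0.
  elim: k => [_|k IH kN].
    have := integral_OmegaZ L 0 (periodic_C_continuous (hphi _ (leq0n N))).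
    rewrite mul0r => <-; apply: eq_integral_Omega => x.
    by rewrite mul0r /delta subrr.
  have [c0 c1] := (periodic_C_continuous (pdelta k (ltnW kN)),
                   periodic_C_continuous (pdelta k.+1 kN)).
  have [k0|k_gt0] := posnP k.
    rewrite k0 in kN *.
    have := integral_Omega_lin L 1 (- 1)
      (periodic_C_continuous (hphi _ kN))
      (periodic_C_continuous (hphi _ (leq0n N))).
    rewrite hmean mulN1r mul1r subrr => <-; apply: eq_integral_Omega => x.
    by rewrite mul1r mulN1r.
  have kN' : (0 < k < N)%N by rewrite k_gt0.
  have := integral_Omega_lin L (a k) (b k) c1 c0.
  rewrite (IH (ltnW kN)) mulr0 addr0.
  rewrite (eq_integral_Omega L (fun x => evolution k x kN')).
  rewrite integral_OmegaZ; last first.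
    exact: (periodic_C_continuous (periodic_C_lap (hmu _ kN'))).
  rewrite (integral_Omega_lap hL (hmu _ kN')) mulr0 => /esym/eqP.
  rewrite mulf_eq0 => /orP[|/eqP//]; rewrite gt_eqF//.
  have g0 := ratio_gt0 _ kN'.
  have theta0 : 0 < theta by lra.
  have tau0 : 0 < tau t k.+1 by exact: tau_gt0.
  apply: divr_gt0; last by apply: mulr_gt0 => //; exact: addr_gt0.
  by apply: addr_gt0 => //; apply: mulr_gt0 => //; exact: mulr_gt0.
have nN0 : (0 < n < N)%N by rewrite n_ge1 ltnW.
have n1N0 : (0 < n.+1 < N)%N by [].
have [pd1 pd0] := (pdelta n.+1 (ltnW nN), pdelta n (ltnW (ltnW nN))).
have [m1 m0] := (delta0 n.+1 (ltnW nN), delta0 n (ltnW (ltnW nN))).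
pose w1 := invlap (delta n.+1); pose w0 := invlap (delta n).
have pw1 : periodic_C L 2 w1 by have [] := hinvlap _ pd1 m1.
have pw0 : periodic_C L 2 w0 by have [] := hinvlap _ pd0 m0.
have [[cw1 cd1] cd0] := (periodic_C_continuous pw1, periodic_C_continuous pd1,
  periodic_C_continuous pd0).
(* The first equation tested with [w1]. *)
have balance : M * integral_Omega L (fun x => mu n x * delta n.+1 x) =
    - (a n * dirichlet L w1 w1 + b n * dirichlet L w1 w0).
  have oppE (x y z y' : R) : x * - y + z * - y' = - (x * y + z * y') by ring.
  have e1 := integral_mul_invlap hL hinvlap pd1 m1 pd1 m1.
  have e0 := integral_mul_invlap hL hinvlap pd1 m1 pd0 m0.
  have e := integral_Omega_lin L (a n) (b n)
    (continuous_mul cd1 cw1) (continuous_mul cd0 cw1).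
  have e' := etrans e (f_equal2 (fun y y' => a n * y + b n * y') e1 e0).
  apply: etrans (etrans e' (oppE _ _ _ _)).
  rewrite -(integral_lap_mul_invlap hL hinvlap pd1 m1 (hmu _ nN0)).
  rewrite -integral_OmegaZ; last first.
    apply: continuous_mul cw1.
    exact: (periodic_C_continuous (periodic_C_lap (hmu _ nN0))).
  apply: eq_integral_Omega => x; rewrite mulrA -evolution//.
  by rewrite mulrDl !mulrA.
pose psi := interp theta phi n.
have [pphi1 pphi0] := (hphi _ (ltnW nN), hphi _ (ltnW (ltnW nN))).
have ppsi : periodic_C L 4 psi := periodic_C_lin theta (1 - theta) pphi1 pphi0.
pose Q x := lam1 / eps ^+ 2 * psi x - lam2 * lap psi x + lam3 * lap (lap psi) x.
have [[cpsi clap] clap2] := (periodic_C_continuous ppsi,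
  periodic_C_continuous (periodic_C_lap ppsi),
  periodic_C_continuous (periodic_C_lap (periodic_C_lap ppsi))).
have QE x : Q x = 1 * (lam1 / eps ^+ 2 * psi x + - lam2 * lap psi x)
    + lam3 * lap (lap psi) x by rewrite mul1r mulNr.
have cQ : continuous Q.
  by rewrite (funext QE); apply: continuous_lin => //; exact: continuous_lin.
(* The second equation tested with the increment, its nonlinear term replaced through the third. *)
have work : integral_Omega L (fun x => mu n x * delta n.+1 x) =
    2 * u n.+1 * (u n.+1 - u n) +
    integral_Omega L (fun x => Q x * delta n.+1 x).
  have [_ muE uE] := hscheme _ nN0.
  apply: (auxiliary_variable_step (periodic_C_continuous (hmu _ nN0)) cQ cd1
    _ (hVpos _) (tau_gt0 n.+1 _) _ uE).
  - by rewrite sqrtr_gt0; apply: hE2; exact: ltnW (ltnW nN).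
  - exact: ltnW nN.
  - case: muE => Z [mZ Z0 sZ]; exists Z; split=> // s /= h; apply: sZ => /= e.
    apply: h => /e {}e; apply: etrans e _.
    have addE (y y' z z' : R) : y + y' - z + z' = y + (y' - z + z') by ring.
    exact: addE.
have QdE : integral_Omega L (fun x => Q x * delta n.+1 x) =
    lam1 / eps ^+ 2 * integral_Omega L (fun x => psi x * delta n.+1 x) -
    lam2 * integral_Omega L (fun x => lap psi x * delta n.+1 x) +
    lam3 * integral_Omega L (fun x => lap (lap psi) x * delta n.+1 x).
  rewrite -mulNr -integral_Omega_lin; [|exact: continuous_mul..].
  rewrite -[X in X + _]mul1r -integral_Omega_lin; last 2 first.
  - by apply: continuous_lin; exact: continuous_mul.
  - exact: continuous_mul.
  have distrE (c1 y1 c2 y2 c3 y3 z : R) : (c1 * y1 - c2 * y2 + c3 * y3) * z =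
      1 * (c1 * (y1 * z) + - c2 * (y2 * z)) + c3 * (y3 * z) by ring.
  by apply: eq_integral_Omega => x; exact: distrE.
have theta_ge : 2^-1 <= theta by case/andP: htheta.
have quad1 := mass_theta_step theta_ge pphi1 pphi0.
have quad2 := gradient_theta_step hL theta_ge pphi1 pphi0.
have quad3 := laplacian_theta_step hL theta_ge pphi1 pphi0.
(* The energy at [n.+1] contains the ratio of index [n.+2], hence the requirement [n.+2 <= N]. *)
have [r1 r1s] := hratio _ nN0; have [r2 r2s] := hratio _ n1N0.
have n_tau : (0 < n <= N)%N by rewrite n_ge1 ltnW// ltnW.
have tauE : tau t n.+1 = step_ratio t n.+1 * tau t n.
  by rewrite divfK// gt_eqF// tau_gt0.
have dissipation := variable_step_dissipation htheta hgamma_star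
  (ratio_gt0 n nN0) r1s r2 r2s (tau_gt0 n n_tau) tauE (dirichlet_ge0 L w1)
  (fun s => dirichlet_young s (periodic_CW pw1) (periodic_CW pw0)).
exact: (energy_decrement hM hlam1 hlam2 hlam3 (exprn_gt0 2 heps)
  (Hm1_normsqE hL hinvlap pd1 m1) (Hm1_normsqE hL hinvlap pd0 m0)
  dissipation balance work QdE quad1 quad2 quad3).
Qed.
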